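(* Let $X$ be a finite digital image, let $Y$ be a digital image, and let $f,g:X\to Y$ be continuous functions which are strongly homotopic. Then $f$ and $g$ are homotopic by a punctuated homotopy, i.e. there is a punctuated homotopy from $f$ to $g$.
   Context: A digital image is a set $X$ together with a symmetric, antireflexive adjacency relation (equivalently, a simple graph). Write $x\leftrightarrow x'$ for ''adjacent'' and $x\mathrel{\underline{\leftrightarrow}} x'$ for ''adjacent or equal''. A function $f:X\to Y$ between digital images is continuous if $x\leftrightarrow x'$ implies $f(x)\mathrel{\underline{\leftrightarrow}} f(x')$. For integers $a\le b$, $[a,b]_{\mathbb Z}=\{a,a+1,\dots,b\}$, with adjacency $c_1$: $s,t$ are adjacent iff $|s-t|=1$. Homotopy: for continuous $f,g:X\to Y$, a homotopy from $f$ to $g$ is a function $H:X\times[0,k]_{\mathbb Z}\to Y$, for some positive integer $k$, with $H(x,0)=f(x)$ and $H(x,k)=g(x)$ for all $x$, such that $t\mapsto H(x,t)$ is continuous for each fixed $x\in X$ and $x\mapsto H(x,t)$ is continuous for each fixed $t\in[0,k]_{\mathbb Z}$. Strong homotopy: the $\mathrm{NP}_2$ adjacency on $X\times[0,k]_{\mathbb Z}$ makes two distinct points $(x,t),(x',t')$ adjacent iff $x\mathrel{\underline{\leftrightarrow}} x'$ and $t\mathrel{\underline{\leftrightarrow}} t'$. A strong homotopy from $f$ to $g$ is a function $H:X\times[0,k]_{\mathbb Z}\to Y$ with $H(x,0)=f(x)$, $H(x,k)=g(x)$ for all $x$, which is continuous with respect to the $\mathrm{NP}_2$ adjacency on the domain.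 If one exists, $f$ and $g$ are strongly homotopic. A homotopy $H:X\times[0,k]_{\mathbb Z}\to Y$ is punctuated if for each $t$ with $0\le t<k$ there is some $x_t$ such that $H(x,t)=H(x,t+1)$ for all $x\neq x_t$; that is, from each stage to the next the map changes by one point at a time.
   Formalization: The digital image X is assumed nonempty: for empty X the empty map is strongly homotopic to itself, but a punctuated homotopy, having k positive, would need a point x_0 in X, so the literal statement fails there. *)

(* Defs.v *)
From mathcomp Require Import all_boot all_order all_algebra.

Set Implicit Arguments.
Unset Strict Implicit.
Unset Printing Implicit Defensive.

(* A digital image (T, a) is given by its set of points T : Type and an
   adjacency a : adjacency T. *)
Record adjacency (T : Type) := Adjacency {
  adj :> T -> T -> Prop;
  adj_sym : forall x y, adj x y -> adj y x;
  adj_irr : forall x, ~ adj x x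
}.

Definition adjeq (T : Type) (a : adjacency T) (x y : T) : Prop :=
  a x y \/ x = y.

Definition continuous (X Y : Type) (aX : adjacency X) (aY : adjacency Y)
    (f : X -> Y) : Prop :=
  forall x x' : X, aX x x' -> adjeq aY (f x) (f x').

(* The digital interval [0, k]_Z is 'I_k.+1; the subtraction below is the one
   of int, not the truncated one of nat. *)
Definition c1_adj (k : nat) (s t : 'I_k.+1) : Prop :=
  `|s%:Z - t%:Z|%R = 1%R.

Lemma c1_adj_sym (k : nat) (s t : 'I_k.+1) : c1_adj s t -> c1_adj t s.
Proof. by rewrite /c1_adj Num.Theory.distrC. Qed.

Lemma c1_adj_irr (k : nat) (s : 'I_k.+1) : ~ c1_adj s s.
Proof. by rewrite /c1_adj GRing.subrr. Qed.

Definition c1 (k : nat) : adjacency 'I_k.+1 :=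
  Adjacency (@c1_adj_sym k) (@c1_adj_irr k).

Definition NP2_adj (S T : Type) (aS : adjacency S) (aT : adjacency T)
    (p q : S * T) : Prop :=
  [/\ p <> q, adjeq aS p.1 q.1 & adjeq aT p.2 q.2].

Lemma adjeq_sym (T : Type) (a : adjacency T) (x y : T) :
  adjeq a x y -> adjeq a y x.
Proof. by case=> [axy|->]; [left; apply: adj_sym | right]. Qed.

Lemma NP2_adj_sym (S T : Type) (aS : adjacency S) (aT : adjacency T)
    (p q : S * T) : NP2_adj aS aT p q -> NP2_adj aS aT q p.
Proof.
by case=> pq h1 h2; split; [move=> /esym | apply: adjeq_sym | apply: adjeq_sym].
Qed.

Lemma NP2_adj_irr (S T : Type) (aS : adjacency S) (aT : adjacency T)
    (p : S * T) : ~ NP2_adj aS aT p p.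
Proof. by case. Qed.

Definition NP2 (S T : Type) (aS : adjacency S) (aT : adjacency T) :
    adjacency (S * T) :=
  Adjacency (@NP2_adj_sym S T aS aT) (@NP2_adj_irr S T aS aT).

Definition is_homotopy (X Y : Type) (aX : adjacency X) (aY : adjacency Y)
    (f g : X -> Y) (k : nat) (H : X * 'I_k.+1 -> Y) : Prop :=
  [/\ forall x, H (x, ord0) = f x,
      forall x, H (x, ord_max) = g x,
      forall x, continuous (c1 k) aY (fun t => H (x, t)) &
      forall t, continuous aX aY (fun x => H (x, t))].

Definition is_strong_homotopy (X Y : Type) (aX : adjacency X)
    (aY : adjacency Y) (f g : X -> Y) (k : nat) (H : X * 'I_k.+1 -> Y) : Prop :=
  [/\ forall x, H (x, ord0) = f x,
      forall x, H (x, ord_max) = g x &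
      continuous (NP2 aX (c1 k)) aY H].

Definition strongly_homotopic (X Y : Type) (aX : adjacency X)
    (aY : adjacency Y) (f g : X -> Y) : Prop :=
  exists (k : nat) (H : X * 'I_k.+1 -> Y),
    0 < k /\ is_strong_homotopy aX aY f g H.

(* For t : 'I_k, the points widen_ord _ t and lift ord0 t of 'I_k.+1 have
   values t and t + 1. *)
Definition punctuated (X Y : Type) (k : nat) (H : X * 'I_k.+1 -> Y) : Prop :=
  forall t : 'I_k, exists xt : X, forall x : X, x <> xt ->
    H (x, widen_ord (leqnSn k) t) = H (x, lift ord0 t).

Definition punctuated_homotopic (X Y : Type) (aX : adjacency X)
    (aY : adjacency Y) (f g : X -> Y) : Prop :=
  exists (k : nat) (H : X * 'I_k.+1 -> Y),
    [/\ 0 < k, is_homotopy aX aY f g H & punctuated H].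

(* Main.v *)
Require Import Defs.
From mathcomp Require Import all_boot all_order all_algebra.
From mathcomp Require Import zify.

(** Refine each unit of time of a strong homotopy into n = #|X| steps, moving
    one point per step: at time t the point of rank r sits at stage
    (t + r) %/ n of the strong homotopy. All ranks are below n, so at any time
    the stages of two points differ by at most 1 and NP_2-continuity yields the
    continuity of each intermediate map; from t to t + 1 only the point with
    n %| (t + r).+1 changes its stage. *)

Definition stage (X : finType) (x : X) (t : nat) : nat :=
  (t + enum_rank x) %/ #|X|.

Lemma stage0 (X : finType) (x : X) : stage X x 0 = 0.
Proof. by rewrite /stage add0n divn_small ?ltn_ord. Qed.

Lemma stageMcard (X : finType) (x : X) (k : nat) : stage X x (k * #|X|) = k.
Proof.
have n_gt0 : 0 < #|X| by apply/card_gt0P; exists x.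
by rewrite /stage divnMDl // divn_small ?addn0 ?ltn_ord.
Qed.

Lemma stageS (X : finType) (x : X) (t : nat) :
  stage X x t.+1 = (#|X| %| (t + enum_rank x).+1) + stage X x t.
Proof.
have n_gt0 : 0 < #|X| by apply/card_gt0P; exists x.
by rewrite /stage addSn divnS.
Qed.

Lemma leq_stage (X : finType) (x : X) (s t : nat) :
  s <= t -> stage X x s <= stage X x t.
Proof. by move=> le_st; rewrite /stage leq_div2r // leq_add2r. Qed.

Lemma stage_leqS (X : finType) (x y : X) (t : nat) :
  stage X x t <= (stage X y t).+1.
Proof.
have n_gt0 : 0 < #|X| by apply/card_gt0P; exists x.
(* The successor is absorbed as an extra [#|X|] in the numerator, which exceeds every rank. *)
rewrite /stage -add1n -divnMDl // leq_div2r // mul1n.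
by rewrite addnCA leq_add2l ltnW // ltn_addr.
Qed.

Lemma stage_stable (X : finType) (t : nat) :
  0 < #|X| ->
  exists xt : X, forall x : X, x <> xt -> stage X x t.+1 = stage X x t.
Proof.
case/card_gt0P=> x0 _.
case: (pickP (fun x : X => #|X| %| (t + enum_rank x).+1)) => [xt xtP|noP].
  exists xt => x x_neq; rewrite stageS.
  case: (boolP (#|X| %| _)) => // xP; case: x_neq; apply: enum_rank_inj.
  (* Ranks are their own residues modulo [#|X|], and adding [t.+1] makes both residues 0. *)
  apply/val_inj/eqP; rewrite /= -(modn_small (ltn_ord (enum_rank x))).
  rewrite -[X in _ == X](modn_small (ltn_ord (enum_rank xt))).
  rewrite -(eqn_modDl t.+1) !addSn.
  by move: xP xtP; rewrite /dvdn => /eqP-> /eqP->.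
(* Nothing moves at this step, so any point can be the witness. *)
by exists x0 => x _; rewrite stageS noP.
Qed.

Lemma adjeq_c1P (k : nat) (s t : 'I_k.+1) :
  s <= t.+1 -> t <= s.+1 -> adjeq (c1 k) s t.
Proof.
move=> s_le t_le; have [->|s_neq_t] := eqVneq s t; first by right.
left; rewrite /= /c1_adj.
have : (s : nat) != t by [].
by lia.
Qed.

Lemma c1_adj_leqS (k : nat) (s t : 'I_k.+1) :
  c1 k s t -> s = t.+1 :> nat \/ t = s.+1 :> nat.
Proof. by rewrite /= /c1_adj; lia. Qed.

(** [NP2] relates only distinct pairs: one adjacent coordinate makes the pairs distinct by
    irreflexivity, and otherwise the two values coincide. *)
Lemma NP2_continuous_adjeq (S T Y : Type) (aS : adjacency S)
    (aT : adjacency T) (aY : adjacency Y) (H : S * T -> Y) (x x' : S)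
    (t t' : T) :
  continuous (NP2 aS aT) aY H -> adjeq aS x x' -> adjeq aT t t' ->
  adjeq aY (H (x, t)) (H (x', t')).
Proof.
move=> H_cont xx' tt'.
case: (xx') => [axx'|eqx]; last case: (tt') => [att'|eqt].
- apply: H_cont; split=> // -[eqx _].
  by apply: (@adj_irr _ aS x'); rewrite -{1}eqx.
- apply: H_cont; split=> // -[_ eqt].
  by apply: (@adj_irr _ aT t'); rewrite -{1}eqt.
- by right; rewrite eqx eqt.
Qed.

Theorem theorem3p2 (X : finType) (Y : Type)
    (aX : adjacency X) (aY : adjacency Y) (X_nonempty : 0 < #|X|)
    (f g : X -> Y)
    (f_cont : continuous aX aY f) (g_cont : continuous aX aY g)
    (fg_strong : strongly_homotopic aX aY f g) :
  punctuated_homotopic aX aY f g.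
Proof.
case: fg_strong => k [H [k_gt0 [H0 Hk H_cont]]].
pose G (p : X * 'I_(k * #|X|).+1) := H (p.1, inord (stage X p.1 p.2)).
(* Stages grow with time and end at [k], so [inord] in [G] never takes its default value. *)
have stage_lt x (t : 'I_(k * #|X|).+1) : stage X x t < k.+1.
  by rewrite -{2}(stageMcard X x k) ltnS leq_stage // -ltnS.
(* This serves both continuity conditions: equal points at consecutive times, and adjacent points at
   one time. *)
have G_adjeq x x' (t t' : 'I_(k * #|X|).+1) : adjeq aX x x' ->
    stage X x t <= (stage X x' t').+1 -> stage X x' t' <= (stage X x t).+1 ->
    adjeq aY (G (x, t)) (G (x', t')).
  move=> xx' le1 le2; apply: NP2_continuous_adjeq H_cont xx' _.
  by apply: adjeq_c1P; rewrite !inordK.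
exists (k * #|X|), G; split; first by rewrite muln_gt0 k_gt0.
- split=> [x|x|x s t /c1_adj_leqS|t x x' axx'].
  + rewrite /G /= stage0 -H0; congr (H (_, _)).
    by apply: val_inj; rewrite /= inordK.
  + rewrite /G /= stageMcard -Hk; congr (H (_, _)).
    by apply: val_inj; rewrite /= inordK.
  + by case=> eq_st; apply: G_adjeq; rewrite ?eq_st ?stageS; (try by right); lia.
  + by apply: G_adjeq; [left | apply: stage_leqS | apply: stage_leqS].
- move=> t; have [xt xtP] := stage_stable X t X_nonempty.
  by exists xt => x /xtP eq_stage; rewrite /G /= /bump /= add1n eq_stage.
Qed.
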